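(* For all $M\ge2$ there exist piecewise $C^1$ compactly supported functions on $\mathbb{R}^d$ which agree with a characteristic function $\chi_B$ on $B_{M/2}$, the ball of radius $M/2$ (i.e. equal $1$ there), and which are in the class $\mathcal{A}$ for some $\eta\in(0,1)$.
   Context: Let $\|u\|_B^2=\sum_{|\alpha+\beta|=2}\|x^\alpha D_x^\beta u\|_{L^2(\mathbb{R}^d)}^2$ (sum over $\alpha,\beta\in\mathbb{N}_0^d$). The class $\mathcal{A}$ consists of $f\in L^2(\mathbb{R}^d)$ with bounded $B$ norm for which there exist a natural number $N>2$, $\eta\in(0,1)$, $\tilde a_n\in\mathbb{R}^d$ and $\tilde c_n\in\mathbb{R}_+$, indexed by $n=(n_1,\dots,n_d)$ with $n_i\in\{0,\dots,N\}$, $|n|=n_1+\dots+n_d\le N$, such that $$\left(\int_{\mathbb{R}^d}\Big|f(x)-\sum_{|n|\le N}\tilde c_ne^{-|x+\tilde a_n|^2}\Big|^2dx\right)^{1/2}\le\eta .$$ ''In $\mathcal{A}$ for some $\eta$'' means this holds with that $\eta$. *)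

(* Defs.v *)
From HB Require Import structures.
From mathcomp Require Import all_boot all_order all_algebra.
From mathcomp Require Import all_classical all_reals all_analysis.
Set Implicit Arguments.
Unset Strict Implicit.
Unset Printing Implicit Defensive.
Import Order.TTheory GRing.Theory Num.Theory.
Import numFieldNormedType.Exports.
Local Open Scope classical_set_scope.
Local Open Scope ring_scope.

Fact rV_display : measure_display. Proof. exact: default_measure_display. Qed.

Section rV_measurable.
Context {R : realType} (d : nat).

Definition rV_coord (i : 'I_d) (x : 'rV[R]_d) : measurableTypeR R := x ord0 i.

Let rV_set0 : g_sigma_preimage rV_coord set0.
Proof. exact: sigma_algebra0. Qed.

Let rV_setC A : g_sigma_preimage rV_coord A ->
  g_sigma_preimage rV_coord (~` A).
Proof. exact: sigma_algebraC. Qed.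

Let rV_bigcup (F : _^nat) : (forall i, g_sigma_preimage rV_coord (F i)) ->
  g_sigma_preimage rV_coord (\bigcup_i (F i)).
Proof. exact: sigma_algebra_bigcup. Qed.

HB.instance Definition _ := @isMeasurable.Build rV_display
  'rV[R]_d (g_sigma_preimage rV_coord) rV_set0 rV_setC rV_bigcup.

End rV_measurable.


Section rV_measurable_theory.
Context {R : realType}.

Lemma measurable_rV_coord d (i : 'I_d) :
  measurable_fun [set: 'rV[R]_d] (rV_coord i).
Proof.
move=> _ Y mY; rewrite setTI; apply: sub_sigma_algebra => /=.
rewrite -bigcup_seq/=; exists i => /=; first by rewrite mem_index_enum.
by exists Y => //; rewrite setTI.
Qed.

Lemma measurable_fun_rV dT (T : measurableType dT) d (f : T -> 'rV[R]_d) :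
  (forall i, measurable_fun [set: T] (rV_coord i \o f)) ->
  measurable_fun [set: T] f.
Proof.
move=> mf _ A mA; rewrite setTI.
suff : [set B | measurable (f @^-1` B)] A by [].
move: A mA; apply: smallest_sub.
  split => /=; first by rewrite preimage_set0.
  - by move=> B mB; rewrite setTD preimage_setC; exact: measurableC.
  - by move=> F mF; rewrite preimage_bigcup; exact: bigcup_measurable.
move=> B; rewrite -bigcup_seq => -[i /= _ [Y mY]]; rewrite setTI => <-.
by rewrite -comp_preimage -[X in measurable X]setTI; exact: mf.
Qed.

Definition cons_rV d (p : measurableTypeR R * 'rV[R]_d) : 'rV[R]_d.+1 :=
  \row_i (if unlift ord0 i is Some j then p.2 ord0 j else p.1).

Definition uncons_rV d (x : 'rV[R]_d.+1) : measurableTypeR R * 'rV[R]_d :=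
  (x ord0 ord0, \row_j x ord0 (lift ord0 j)).

Lemma cons_rVK d : cancel (@cons_rV d) (@uncons_rV d).
Proof.
move=> [a x]; congr (_, _); first by rewrite mxE unlift_none.
by apply/rowP => j; rewrite !mxE liftK.
Qed.

Lemma measurable_cons_rV d : measurable_fun setT (@cons_rV d).
Proof.
apply: measurable_fun_rV => i.
have [j ->|->] := unliftP ord0 i.
  rewrite (_ : _ \o _ = rV_coord j \o snd).
    by apply: measurableT_comp => //; exact: measurable_rV_coord.
  by apply/funext => p; rewrite /= /rV_coord mxE liftK.
rewrite (_ : _ \o _ = fst) //.
by apply/funext => p; rewrite /= /rV_coord mxE unlift_none.
Qed.

Lemma measurable_uncons_rV d : measurable_fun setT (@uncons_rV d).
Proof.
apply/measurable_fun_pairP; split; first exact: (measurable_rV_coord ord0).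
apply: measurable_fun_rV => j.
rewrite (_ : _ \o _ = rV_coord (lift ord0 j)); first exact: measurable_rV_coord.
by apply/funext => x; rewrite /= /rV_coord mxE.
Qed.

End rV_measurable_theory.

Section lebesgue_rV.
Context {R : realType}.
Local Open Scope ereal_scope.

Section step.
Context d (m : {sigma_finite_measure set 'rV[R]_d -> \bar R}).

Definition lebesgue_cons (A : set 'rV[R]_d.+1) : \bar R :=
  ((@lebesgue_measure R) \x m) (@cons_rV R d @^-1` A).

Let cons0 : lebesgue_cons set0 = 0.
Proof. by rewrite /lebesgue_cons preimage_set0 measure0. Qed.

Let cons_ge0 A : 0 <= lebesgue_cons A.
Proof. exact: measure_ge0. Qed.

Let cons_sigma_additive : semi_sigma_additive lebesgue_cons.
Proof.
have mc (B : set 'rV[R]_d.+1) : measurable B ->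
    measurable (@cons_rV R d @^-1` B).
  by move=> mB; rewrite -[X in measurable X]setTI; exact: measurable_cons_rV.
move=> F mF tF mUF; rewrite /lebesgue_cons preimage_bigcup.
apply: measure_semi_sigma_additive.
- by move=> n; exact: mc.
- apply/trivIsetP => /= i j _ _ ij; rewrite -preimage_setI.
  by move/trivIsetP : tF => /(_ _ _ _ _ ij) ->//; rewrite preimage_set0.
- by rewrite -preimage_bigcup; exact: mc.
Qed.

HB.instance Definition _ := isMeasure.Build _ _ _ lebesgue_cons
  cons0 cons_ge0 cons_sigma_additive.

Let cons_sigma_finite : sigma_finite setT lebesgue_cons.
Proof.
have /sigma_finiteP[F [FT ndF mF]] := sigma_finiteT (@lebesgue_measure R).
have /sigma_finiteP[G [GT ndG mG]] := sigma_finiteT m.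
exists (fun k => @uncons_rV R d @^-1` (F k `*` G k)).
  rewrite -preimage_bigcup -[LHS](preimage_setT (@uncons_rV R d));
    congr (_ @^-1` _).
  rewrite -setXTT FT GT predeqE => -[x y]; split.
    move=> [/= [n _ Fnx] [k _ Gky]]; exists (maxn n k) => //; split.
    - by move: x Fnx; exact/subsetPset/ndF/leq_maxl.
    - by move: y Gky; exact/subsetPset/ndG/leq_maxr.
  by move=> [n _ []/= ? ?]; split; exists n.
move=> k; have [mFk Fkoo] := mF k; have [mGk Gkoo] := mG k; split.
  rewrite -[X in measurable X]setTI.
  by apply: measurable_uncons_rV => //; exact: measurableX.
rewrite /lebesgue_cons -comp_preimage (_ : _ \o _ = id); last first.
  by apply/funext => x; exact: cons_rVK.
by rewrite product_measure1E// lte_mul_pinfty// ge0_fin_numE.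
Qed.

HB.instance Definition _ := Measure_isSigmaFinite.Build _ _ _ lebesgue_cons
  cons_sigma_finite.

End step.

(* The d-fold product of the Lebesgue measure on R. *)
Fixpoint lebesgue_rV d : {sigma_finite_measure set 'rV[R]_d -> \bar R} :=
  if d is d'.+1 then lebesgue_cons (lebesgue_rV d') else \d_(0%R : 'rV[R]_0).

Lemma lebesgue_rV_box d (A : 'I_d -> set (measurableTypeR R)) :
  (forall i, measurable (A i)) ->
  lebesgue_rV d [set x | forall i, A i (x ord0 i)] =
  \prod_(i < d) lebesgue_measure (A i).
Proof.
elim: d A => [|d IHd] A mA /=.
  rewrite big_ord0 diracE mem_set//=; by case.
have mB : measurable [set x : 'rV[R]_d | forall i, A (lift ord0 i) (x ord0 i)].
  rewrite (_ : mkset _ = \big[setI/setT]_(i < d)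
      (@rV_coord R d i @^-1` A (lift ord0 i))).
    apply: bigsetI_measurable => i _.
    by rewrite -[X in measurable X]setTI; exact: measurable_rV_coord.
  rewrite -bigcap_seq; apply/seteqP; split=> x /= Ax i.
    by move=> _; exact: Ax.
  by apply: Ax; rewrite /= mem_index_enum.
rewrite big_ord_recl -IHd // -product_measure1E //.
rewrite /lebesgue_cons; congr (_ _); apply/seteqP; split=> -[a x] /=.
  move=> Ax; split=> [|j] /=.
    by have := Ax ord0; rewrite mxE unlift_none.
  by have := Ax (lift ord0 j); rewrite mxE liftK.
move=> [Aa Ax] i; rewrite mxE.
by case: unliftP => [j|] ->.
Qed.

End lebesgue_rV.

Section calculus.
Context {R : realType} {d : nat}.
Local Notation V := 'rV[R]_d.
Implicit Types (f g u v phi : V -> R) (x : V).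

(* The canonical norm on row vectors is the sup norm. *)
Definition enorm x : R := Num.sqrt (\sum_(i < d) x ord0 i ^+ 2).

Definition partial (i : 'I_d) f : V -> R := fun x => 'D_(delta_mx ord0 i) f x.

Definition partials (s : seq 'I_d) f : V -> R := foldr partial f s.

Definition Ck (k : nat) f := forall s : seq 'I_d, (size s <= k)%N ->
  continuous (partials s f) /\
  ((size s < k)%N ->
    forall i x, derivable (partials s f) x (delta_mx ord0 i)).

Definition compactly_supported f := compact (closure [set x | f x != 0]).

Definition test_function phi := (forall k, Ck k phi) /\ compactly_supported phi.

(* Finitely many open pieces with null boundary, f being C^1 up to the boundary
   of each of them (so f is continuous, the closed pieces covering the space). *)
Definition piecewise_C1 f :=
  exists (k : nat) (U : 'I_k -> set V) (g : 'I_k -> V -> R),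
    [/\ forall i, open (U i),
        trivIset setT U,
        \bigcup_i closure (U i) = setT,
        forall i, (lebesgue_rV d).-negligible (closure (U i) `\` U i) &
        forall i, Ck 1 (g i) /\ {in closure (U i), f =1 g i}].

(* Multi-indices with entries in {0, ..., k}. *)
Definition mindex (k : nat) := {ffun 'I_d -> 'I_k.+1}.

Definition mdeg k (a : mindex k) : nat := (\sum_(i < d) a i)%N.

Definition monomial k (a : mindex k) x : R := \prod_(i < d) x ord0 i ^+ a i.

Definition mpartial k (b : mindex k) f : V -> R :=
  partials (flatten [seq nseq (b i) i | i <- enum 'I_d]) f.

Definition locally_integrable_rV f := measurable_fun [set: V] f /\
  forall K : set V, compact K ->
    (lebesgue_rV d).-integrable K (EFin \o f).

Definition weak_mpartial k (b : mindex k) u v :=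
  [/\ locally_integrable_rV u, locally_integrable_rV v &
      forall phi, test_function phi ->
        (\int[lebesgue_rV d]_x (u x * mpartial b phi x)%:E =
         ((-1) ^+ mdeg b)%:E * \int[lebesgue_rV d]_x (v x * phi x)%:E)%E].

End calculus.
Arguments mindex : clear implicits.

Section class_A.
Context {R : realType} {d : nat}.
Local Notation V := 'rV[R]_d.
Local Notation mu := (@lebesgue_rV R d).
Local Open Scope ereal_scope.

(* ||x^a D^b u||_2, with value +oo when the distribution D^b u is not a locally
   integrable function. Using d/dx_j for D_j = -i d/dx_j changes no norm. *)
Definition Lnorm_monomial_D k (a b : mindex d k) (u : V -> R) : \bar R :=
  ereal_inf ((fun v : V -> R =>
      'N[mu]_2%:E[EFin \o (fun x => monomial a x * v x)%R])
    @` [set v | weak_mpartial b u v]).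

Definition Bnorm (u : V -> R) : \bar R :=
  (\sum_(p : mindex d 2 * mindex d 2 | (mdeg p.1 + mdeg p.2 == 2)%N)
     Lnorm_monomial_D p.1 p.2 u ^+ 2) `^ (2^-1)%R.

Definition gaussian_sum N (c : mindex d N -> R) (a : mindex d N -> V) (x : V)
    : R :=
  \sum_(n : mindex d N | (mdeg n <= N)%N)
    (c n * expR (- enorm (x + a n) ^+ 2))%R.

Definition classA_for (eta : R) (f : V -> R) :=
  [/\ f \in Lfun mu 2%:E, Bnorm f < +oo, (0 < eta < 1)%R &
      exists N : nat, (2 < N)%N /\
      exists (a : mindex d N -> V) (c : mindex d N -> R),
        (forall n, (mdeg n <= N)%N -> (0 < c n)%R) /\
        'N[mu]_2%:E[EFin \o (fun x => f x - gaussian_sum c a x)%R] <= eta%:E].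

End class_A.

(* Main.v *)
Require Import Defs.
From HB Require Import structures.
From mathcomp Require Import all_boot all_order all_algebra.
From mathcomp Require Import all_classical all_reals all_analysis.
From mathcomp Require Import measurable_realfun zify ring lra.
Import Order.TTheory GRing.Theory Num.Theory.
Import numFieldNormedType.Exports.
Local Open Scope classical_set_scope.
Local Open Scope ring_scope.
Set Implicit Arguments.
Unset Strict Implicit.
Unset Printing Implicit Defensive.

(* Since [e^{b.x} e^{-|x|^2}] is a positive multiple of a translate of
   [e^{-|x|^2}], the positive combinations of translated Gaussians are the
   functions [e^{-|x|^2} h(x)] with [h] a positive finite sum of exponentials.
   Taking [h(x) = \prod_i cosh(x_i / m)^(2 m^2)], the bounds
   [1 + s^2/2 <= cosh s <= e^{s^2/2}] give
   [1 - |x|^4 / (2 m^2) <= e^{-|x|^2} h(x) <= 1], so that the Gaussian sum [g]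
   tends to [1] uniformly on compact sets.  Then [f] is [1] near the ball of
   radius [M/2], equal to [g] further away, and cut off far away, with [C^2]
   transitions; both errors are pointwise at most [eps e^{-|x|^2}] in square.
   The [B]-norm of [f] is finite because the weak derivatives of order at most 2
   of a compactly supported [C^2] function are its classical ones. *)

(** * Measurability and integration on row vectors *)

Section measurability.
Context {R : realType}.
Implicit Type d : nat.

Lemma rV_ballE d (x : 'rV[R]_d) (e : R) : 0 < e ->
  ball x e = [set y | forall i, `|x ord0 i - y ord0 i| < e].
Proof.
move=> e0; apply/seteqP; split=> [y [_ xy] i|y xy]; first exact: xy.
by split=> // i j; rewrite (ord1 i); exact: xy.
Qed.

(** Balls of the sup norm are boxes, hence finite intersections of coordinate preimages, and these
    generate the sigma-algebra. *)
Lemma measurable_rV_ball d (x : 'rV[R]_d) (e : R) : 0 < e -> measurable (ball x e).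
Proof.
move=> e0; rewrite rV_ballE//.
rewrite [X in measurable X](_ : _ = \big[setI/setT]_(i < d)
    (@rV_coord R d i @^-1` [set t | `|x ord0 i - t| < e])).
  apply: bigsetI_measurable => i _; rewrite -[X in measurable X]setTI.
  apply: measurable_rV_coord => //.
  rewrite [X in measurable X](_ : _ = ball (x ord0 i) e)//.
  exact: measurable_ball.
rewrite -bigcap_seq; apply/seteqP; split=> y /= xy i; first by move=> _; exact: xy.
by apply: xy; rewrite /= mem_index_enum.
Qed.

(* Second countability: [U] is the union of the balls of rational centre and
   radius [1/(n+1)] that it contains. *)
Lemma open_measurable_rV d (U : set 'rV[R]_d) : open U -> measurable U.
Proof.
move=> oU.
pose B (p : 'rV[rat]_d * nat) : set 'rV[R]_d :=
  ball (map_mx (ratr : rat -> R) p.1) p.2.+1%:R^-1.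
pose F p := if `[< B p `<=` U >] then B p else set0.
rewrite (_ : U = \bigcup_p F p).
  apply: countable_bigcupT_measurable; first exact: countableP.
  by move=> p; rewrite /F; case: ifP => // _; apply: measurable_rV_ball.
apply/seteqP; split=> [x Ux|x [p _]]; last first.
  by rewrite /F; case: ifPn => [/asboolP pU /pU|].
have /nbhs_ballP[e /= e0 eU] := oU _ Ux.
have [n _ ne] : exists2 n, True & n.+1%:R^-1 < e / 2.
  have [n _ /(_ n (leqnn n))] := near_infty_natSinv_lt (PosNum (divr_gt0 e0 (ltr0n R 2))).
  by exists n.
have n0 : 0 < n.+1%:R^-1 :> R by rewrite invr_gt0.
have /choice[q qx] : forall i, exists q : rat, `|x ord0 i - ratr q| < n.+1%:R^-1.
  move=> i; have xn : x ord0 i - n.+1%:R^-1 < x ord0 i + n.+1%:R^-1.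
    by rewrite ltrD2l gtrN.
  have [q] := rat_in_itvoo xn.
  rewrite in_itv/= => /andP[q1 q2]; exists q.
  by rewrite distrC ltr_distl q1.
have Bx : B (\row_i q i, n) x.
  by rewrite /B rV_ballE//= => i; rewrite !mxE distrC; exact: qx.
exists (\row_i q i, n) => //; rewrite /F asboolT// => y By; apply: eU.
rewrite rV_ballE// => i; move: By; rewrite /B rV_ballE//= => /(_ i).
rewrite !mxE => yq; rewrite -(subrK (ratr (q i)) (x ord0 i)) -addrA.
rewrite (le_lt_trans (ler_normD _ _))// [ltRHS]splitr.
by rewrite ltrD// (lt_trans _ ne)//; exact: qx.
Qed.

Lemma closed_measurable_rV d (U : set 'rV[R]_d) : closed U -> measurable U.
Proof.
by move=> cU; rewrite -(setCK U); apply: measurableC; apply: open_measurable_rV;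
  exact: closed_openC.
Qed.

Lemma continuous_measurable_rV d (f : 'rV[R]_d -> R) :
  continuous f -> measurable_fun setT f.
Proof.
move=> cf; apply: (measurability _ (@RGenOpens.measurableE R)) => _ [_ [a [b ->] <-]].
rewrite setTI; apply: open_measurable_rV; apply: open_comp => // x _; exact: cf.
Qed.

End measurability.

Section integral.
Context {R : realType}.
Implicit Type d : nat.
Local Notation leb := (@lebesgue_measure R).
Local Notation mu := (@lebesgue_rV R _).
Local Open Scope ereal_scope.

(** The measure in dimension [d.+1] is by construction the image of the product measure under
    [cons_rV], so this is the change of variables for an image measure. It prepares the inductions
    on the dimension by Fubini. *)
Lemma ge0_integral_rVS d (F : 'rV[R]_d.+1 -> \bar R) :
  measurable_fun setT F -> (forall x, 0 <= F x) ->
  \int[mu]_x F x = \int[leb \x lebesgue_rV d]_p F (cons_rV p).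
Proof.
by move=> mF F0; rewrite -(ge0_integral_pushforward (@measurable_cons_rV R d) _ measurableT).
Qed.

Lemma integrable_rVS d (F : 'rV[R]_d.+1 -> \bar R) :
  (lebesgue_rV d.+1).-integrable setT F ->
  (leb \x lebesgue_rV d).-integrable setT (F \o @cons_rV R d).
Proof.
move=> /integrableP[mF Foo]; apply/integrableP; split.
  exact: measurableT_comp (@measurable_cons_rV R d).
rewrite -(ge0_integral_rVS (F := abse \o F))//=; exact: measurableT_comp.
Qed.

Lemma integral_rVS d (F : 'rV[R]_d.+1 -> \bar R) :
  (lebesgue_rV d.+1).-integrable setT F ->
  \int[mu]_x F x = \int[leb \x lebesgue_rV d]_p F (cons_rV p).
Proof.
move=> iF; have /integrableP[mF _] := iF.
have -> : \int[leb \x lebesgue_rV d]_p F (cons_rV p) =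
    \int[pushforward (leb \x lebesgue_rV d) (@cons_rV R d)]_x F x.
  rewrite (integral_pushforward (@measurable_cons_rV R d) mF)//.
  by rewrite preimage_setT; exact: integrable_rVS.
by [].
Qed.

Lemma enorm_sqr d (x : 'rV[R]_d) : (enorm x ^+ 2 = \sum_(i < d) x ord0 i ^+ 2)%R.
Proof. by rewrite /enorm sqr_sqrtr// sumr_ge0// => i _; rewrite sqr_ge0. Qed.

Lemma enorm_sqr_continuous d : continuous (fun x : 'rV[R]_d => enorm x ^+ 2)%R.
Proof.
rewrite (_ : (fun _ => _) = fun x : 'rV[R]_d => \sum_(i < d) x ord0 i ^+ 2)%R; last first.
  by apply/funext => x; exact: enorm_sqr.
apply: continuous_big => [|i _ x]; first exact: add_continuous.
apply: (@continuous_comp _ _ _ (fun x : 'rV[R]_d => x ord0 i) (fun t => t ^+ 2)%R).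
  exact: coord_continuous.
exact: exprn_continuous.
Qed.

Lemma gauss_rV_continuous d : continuous (fun x : 'rV[R]_d => expR (- enorm x ^+ 2)).
Proof.
move=> x; apply: continuous_comp; last exact: continuous_expR.
by apply: continuousN; exact: enorm_sqr_continuous.
Qed.

Lemma measurable_gauss_rV d :
  measurable_fun setT (fun x : 'rV[R]_d => (expR (- enorm x ^+ 2))%:E).
Proof.
by apply/measurable_EFinP; apply: continuous_measurable_rV; exact: gauss_rV_continuous.
Qed.

(** Induction on [d]: the Gaussian is a product of a function of the first coordinate and one of the
    others, and Tonelli brings out one factor $\sqrt\pi$. In dimension 0 the measure is a unit mass
    at the only point. *)
Lemma integral_gauss_rV d :
  \int[mu]_(x in [set: 'rV[R]_d]) (expR (- enorm x ^+ 2))%:E = (Num.sqrt pi ^+ d)%:E.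
Proof.
have W0 n (x : 'rV[R]_n) : 0 <= (expR (- enorm x ^+ 2))%:E by rewrite lee_fin expR_ge0.
elim: d => [|d IH].
  rewrite integral_dirac//; last exact: measurable_gauss_rV.
  by rewrite diracE in_setT mul1e enorm_sqr big_ord0 oppr0 expR0.
rewrite ge0_integral_rVS//; last exact: measurable_gauss_rV.
have gE (t : R) (y : 'rV[R]_d) :
    expR (- enorm (cons_rV (t, y)) ^+ 2) = (gauss_fun t * expR (- enorm y ^+ 2))%R.
  rewrite /gauss_fun -expRD -opprD; congr (expR (- _)).
  rewrite !enorm_sqr big_ord_recl mxE unlift_none; congr (_ + _)%R.
  by apply: eq_bigr => i _; rewrite mxE liftK.
rewrite fubini_tonelli1//; last first.
  exact: measurableT_comp (@measurable_gauss_rV d.+1) (@measurable_cons_rV R d).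
transitivity (\int[leb]_x ((gauss_fun x)%:E * (Num.sqrt pi ^+ d)%:E)).
  apply: eq_integral => t _; rewrite /fubini_F.
  under eq_integral do rewrite gE EFinM.
  rewrite ge0_integralZl ?IH//; first exact: measurable_gauss_rV.
  by rewrite lee_fin expR_ge0.
rewrite ge0_integralZr//.
- by rewrite integralT_gauss -EFinM exprS.
- by apply/measurable_EFinP; exact: measurable_gauss_fun.
- by move=> x _; rewrite lee_fin expR_ge0.
Qed.

End integral.

(** * Functions of class C^k *)

Section line.
Context {R : realType} {V : normedModType R}.
Implicit Types (f : V -> R) (p : R -> R).

(** The difference quotients on the two sides are the same function. One-variable rules thus apply
    to directional derivatives without total differentiability of [f]. *)
Lemma derive_lineE f (x v : V) :
  (derivable f x v <-> derivable (fun h : R => f (h *: v + x)) 0 1) *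
  ('D_v f x = 'D_1 (fun h : R => f (h *: v + x)) 0).
Proof.
have E : (fun h : R => h^-1 *: ((f \o shift x) (h *: v) - f x)) =
    (fun h : R => h^-1 *: (((fun h : R => f (h *: v + x)) \o shift 0) (h *: 1)
                           - f (0 *: v + x))).
  by apply/funext => h /=; rewrite addr0 scale0r add0r [h *: 1]mulr1.
by split; rewrite /derivable /derive E.
Qed.

Lemma is_derive_line f (x v : V) a :
  is_derive x v f a <-> is_derive (0 : R) 1 (fun h : R => f (h *: v + x)) a.
Proof.
have [D1 D2] := derive_lineE f x v.
split=> -[D3 D4]; constructor; first exact/D1.
- by rewrite -D2.
- exact/D1.
- by rewrite D2.
Qed.

Lemma is_derive_compl p f (x v : V) (a b : R) :
  is_derive (f x) 1 p a -> is_derive x v f b -> is_derive x v (p \o f) (a * b).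
Proof.
move=> pa /is_derive_line fb; apply/is_derive_line.
by apply: (@is_derive1_comp _ p) fb; rewrite scale0r add0r.
Qed.

End line.

Section Ck.
Context {R : realType} {d : nat}.
Local Notation V := 'rV[R]_d.
Implicit Types (f g : V -> R) (p q : R -> R) (k : nat).

Lemma partials_rcons (s : seq 'I_d) i f :
  partials (rcons s i) f = partials s (partial i f).
Proof. exact: foldr_rcons. Qed.

(** [partials] applies the last direction of the list first, so taking off the last entry exposes
    the innermost derivative. This recursive form drives the inductions on [k]. *)
Lemma CkS k f : Ck k.+1 f <->
  [/\ continuous f, forall i x, derivable f x (delta_mx ord0 i) &
      forall i, Ck k (partial i f)].
Proof.
split=> [Cf|[cf df Cf]].
  have [cf df] := Cf [::] (leq0n _); split=> // [|i s sk]; first exact: df.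
  have := Cf (rcons s i); rewrite size_rcons !ltnS partials_rcons => /(_ sk).
  by [].
move=> s; have [->|s0] := eqVneq s [::]; first by split.
case/lastP: s s0 => [|s i _]; first by rewrite eqxx.
rewrite size_rcons !ltnS partials_rcons => sk.
exact: Cf.
Qed.

Lemma Ck_continuous k f : Ck k f -> continuous f.
Proof. by move=> /(_ [::])[]. Qed.

Lemma Ck0 f : continuous f -> Ck 0 f.
Proof. by move=> cf [|//] _; split. Qed.

Lemma Ck_leq k m f : (m <= k)%N -> Ck k f -> Ck m f.
Proof.
move=> mk Cf s sm; have [cf df] := Cf s (leq_trans sm mk); split=> // {}sm.
exact/df/(leq_trans sm).
Qed.

Lemma Ck_cst k (c : R) : Ck k (fun _ : V => c).
Proof.
elim: k c => [|k IH] c; first by apply: Ck0 => x; exact: cst_continuous.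
apply/CkS; split=> [x|i x|i]; [exact: cst_continuous|exact: derivable_cst|].
rewrite [partial _ _](_ : _ = fun=> 0); first exact: IH.
by apply/funext => x; rewrite /partial derive_cst.
Qed.

Lemma Ck_add k f g : Ck k f -> Ck k g -> Ck k (fun x => f x + g x).
Proof.
elim: k f g => [|k IH] f g Cf Cg.
  apply: Ck0 => x; apply: continuousD; first exact: Ck_continuous Cf _.
  exact: Ck_continuous Cg _.
have [/CkS[cf df Cdf] /CkS[cg dg Cdg]] := (Cf, Cg).
apply/CkS; split=> [x|i x|i]; [|exact: derivableD|].
  by apply: continuousD; [exact: cf|exact: cg].
rewrite [partial _ _](_ : _ = fun x => partial i f x + partial i g x).
  exact: IH.
by apply/funext => x; rewrite /partial deriveD.
Qed.

Lemma Ck_mul k f g : Ck k f -> Ck k g -> Ck k (fun x => f x * g x).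
Proof.
elim: k f g => [|k IH] f g Cf Cg.
  apply: Ck0 => x; apply: continuousM; first exact: Ck_continuous Cf _.
  exact: Ck_continuous Cg _.
have [/CkS[cf df Cdf] /CkS[cg dg Cdg]] := (Cf, Cg).
apply/CkS; split=> [x|i x|i]; [|exact: derivableM|].
  by apply: continuousM; [exact: cf|exact: cg].
rewrite [partial _ _](_ : _ = fun x => f x * partial i g x + g x * partial i f x).
  apply: Ck_add; first exact: IH (Ck_leq (leqnSn k) Cf) (Cdg i).
  exact: IH (Ck_leq (leqnSn k) Cg) (Cdf i).
by apply/funext => x; rewrite /partial deriveM.
Qed.

Lemma Ck_sum k (I : Type) (r : seq I) (P : pred I) (F : I -> V -> R) :
  (forall i, Ck k (F i)) -> Ck k (fun x => \sum_(i <- r | P i) F i x).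
Proof.
move=> CF; elim: r => [|i r IH].
  by under eq_fun do rewrite big_nil; exact: Ck_cst.
under eq_fun do rewrite big_cons.
case: (P i); last exact: IH.
exact: Ck_add (CF i) IH.
Qed.

Lemma Ck_coord k i : Ck k (fun x : V => x ord0 i).
Proof.
have D x j : is_derive x (delta_mx ord0 j) (fun x : V => x ord0 i) (i == j)%:R.
  apply/is_derive_line.
  rewrite (_ : (fun _ => _) = (fun h : R => h * (i == j)%:R + x ord0 i)).
    by apply: is_derive_eq; rewrite addr0 scaler0 add0r [_ *: _]mulr1.
  by apply/funext => h; rewrite !mxE eqxx/=.
case: k => [|k]; first by apply: Ck0 => x; exact: coord_continuous.
apply/CkS; split=> [x|j x|j]; first exact: coord_continuous.
  by have [] := D x j.
rewrite [partial _ _](_ : _ = fun=> (i == j)%:R); first exact: Ck_cst.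
by apply/funext => x; rewrite /partial derive_val.
Qed.

(** The one-variable class carries each derivative as a witness, which is what the chain rule in
    [Ck_comp] consumes. *)
Fixpoint Ck1 k p : Prop :=
  if k is k'.+1 then exists2 q, forall t : R, is_derive t 1 p (q t) & Ck1 k' q
  else continuous p.

Lemma Ck1_continuous k p : Ck1 k p -> continuous p.
Proof.
case: k => [//|k] [q pq _] t; apply: differentiable_continuous.
by apply/derivable1_diffP; case: (pq t).
Qed.

Lemma Ck_comp k p f : Ck1 k p -> Ck k f -> Ck k (fun x => p (f x)).
Proof.
elim: k p f => [|k IH] p f Cp Cf.
  apply: Ck0 => x; apply: continuous_comp; last exact: Cp.
  exact: Ck_continuous Cf _.
have /CkS[cf df Cdf] := Cf; have [q pq Cq] := Cp.
have D i x : is_derive x (delta_mx ord0 i) (fun x => p (f x)) (q (f x) * partial i f x).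
  by apply: (@is_derive_compl _ _ p f) => //; exact/derivableP.
apply/CkS; split=> [x|i x|i]; first 2 last.
- rewrite [partial _ _](_ : _ = fun x => q (f x) * partial i f x).
    by apply: Ck_mul; [exact: IH Cq (Ck_leq (leqnSn k) Cf)|exact: Cdf].
  by apply/funext => x; rewrite {1}/partial derive_val.
- apply: continuous_comp; first exact: cf.
  exact: Ck1_continuous Cp _.
- by have [] := D i x.
Qed.

Lemma Ck1_expR k : Ck1 k (@expR R).
Proof.
elim: k => [|k IH]; first by move=> t; exact: continuous_expR.
by exists expR => // t; exact: is_derive_expR.
Qed.

End Ck.

(** * C^2 cutoffs built from cubes of positive parts *)

Section cutoff.
Context {R : realType}.
Implicit Types t : R.

Definition pos_part t : R := Num.max t 0.

Lemma pos_part_continuous : continuous pos_part.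
Proof. by move=> t; apply: continuous_max; [exact: cvg_id|exact: cst_continuous]. Qed.

(** A quadratic remainder, whatever the sign of [t]: it yields the derivative of $t_+^2$ at the kink
    and elsewhere in one stroke. *)
Lemma pos_part_sqr_dist (t h : R) :
  `|pos_part (t + h) ^+ 2 - pos_part t ^+ 2 - h * (2 * pos_part t)| <= h ^+ 2.
Proof.
rewrite /pos_part ler_norml.
have [th|th] := leP (t + h) 0; have [t0|t0] := leP t 0; apply/andP; split; nra.
Qed.

Lemma is_derive_pos_part2 t :
  is_derive t 1 (fun t => pos_part t ^+ 2) (2 * pos_part t).
Proof.
set F := fun t => _.
have D : h^-1 *: ((F \o shift t) (h *: 1) - F t) @[h --> 0^'] --> 2 * pos_part t.
  apply/cvgrPdist_lt => e e0; near=> h.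
  have h0 : h != 0 by near: h; exact: nbhs_dnbhs_neq.
  rewrite distrC -(ltr_pM2l (_ : 0 < `|h|)) ?normr_gt0// -normrM mulrBr.
  rewrite mulVKf//.
  rewrite [h *: 1]mulr1 /= [h + t]addrC (le_lt_trans (pos_part_sqr_dist _ _))//.
  rewrite -real_normK ?num_real// expr2 ltr_pM2l ?normr_gt0//.
  near: h; apply: dnbhs0_lt => //.
constructor; first by apply/cvg_ex; eexists; exact: D.
exact: cvg_lim D.
Unshelve. all: by end_near. Qed.

Lemma is_derive_pos_part3 t :
  is_derive t 1 (fun t => pos_part t ^+ 3) (3 * pos_part t ^+ 2).
Proof.
(* Since $t_+^3 = t \cdot t_+^2$, the product rule replaces a second remainder estimate. *)
rewrite (_ : (fun _ => _) = id * (fun t => pos_part t ^+ 2)); last first.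
  apply/funext => s; change (pos_part s ^+ 3 = s * pos_part s ^+ 2).
  by rewrite exprS /pos_part; have [s0|//] := leP s 0; rewrite expr0n !mulr0.
have := is_derive_pos_part2 t => D.
apply: is_derive_eq.
rewrite /pos_part; have [t0|t0] := leP t 0; rewrite /GRing.scale/=; ring.
Qed.

Lemma Ck1_pos_part3 : Ck1 2 (fun t => pos_part t ^+ 3).
Proof.
exists (fun t => 3 * pos_part t ^+ 2); first exact: is_derive_pos_part3.
have c : continuous (fun t => 3 * (2 * pos_part t)).
  rewrite (_ : (fun _ => _) = ( *%R 6) \o pos_part).
    by move=> t; apply: continuous_comp; [exact: pos_part_continuous|exact: mulrl_continuous].
  by apply/funext => t /=; ring.
exists (fun t => 3 * (2 * pos_part t)); last exact: c.
move=> t; have D := is_derive_pos_part2 t; apply: is_derive_eq.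
by rewrite /GRing.scale/=; ring.
Qed.

(** The inner cube smooths the junction at 0 and the outer one the junction at 1. Cubes of positive
    parts are $C^2$, which suffices because the $B$-norm involves derivatives of order at most 2. *)
Definition cutoff (u : R) : R := pos_part (1 - pos_part u ^+ 3) ^+ 3.

Lemma cutoff1 u : u <= 0 -> cutoff u = 1.
Proof. by move=> u0; rewrite /cutoff /pos_part (max_r u0) expr0n subr0 max_l// expr1n. Qed.

Lemma cutoff0 u : 1 <= u -> cutoff u = 0.
Proof.
move=> u1; have -> : cutoff u = pos_part (1 - u ^+ 3) ^+ 3.
  by rewrite /cutoff [pos_part u]max_l// (le_trans ler01).
by rewrite /pos_part max_r ?expr0n// subr_le0 exprn_ege1.
Qed.

Lemma cutoff_itv u : 0 <= cutoff u <= 1.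
Proof.
have p0 v : 0 <= pos_part v by rewrite /pos_part le_max lexx orbT.
apply/andP; split; first exact/exprn_ge0/p0.
apply: exprn_ile1; first exact: p0.
rewrite {1}/pos_part ge_max ler01 andbT.
by rewrite lerBlDr lerDl exprn_ge0// p0.
Qed.

Lemma Ck_cutoff d (u : 'rV[R]_d -> R) : Ck 2 u -> Ck 2 (fun x => cutoff (u x)).
Proof.
move=> Cu; apply: (Ck_comp Ck1_pos_part3).
rewrite (_ : (fun _ => _) = fun x => 1 + (-1) * pos_part (u x) ^+ 3).
  apply: Ck_add; first exact: Ck_cst.
  apply: Ck_mul; first exact: Ck_cst.
  exact: (Ck_comp Ck1_pos_part3).
by apply/funext => x; rewrite mulN1r.
Qed.

End cutoff.

(** * Compact supports and Gaussian bounds *)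

Section compact_support.
Context {R : realType} {d : nat}.
Local Notation V := 'rV[R]_d.
Local Notation mu := (@lebesgue_rV R d).
Implicit Types (f g u v : V -> R) (r : R).

(** The bound [r] is on the squared norm, a polynomial. The strict inequality makes the outer region
    open, so that partial derivatives vanish on it too. *)
Definition vanishes_outside r f := forall x, r < enorm x ^+ 2 -> f x = 0.

Lemma sqr_coord_le (x : V) i : x ord0 i ^+ 2 <= enorm x ^+ 2.
Proof.
rewrite enorm_sqr (bigD1 i)//= lerDl.
by apply: sumr_ge0 => j _; exact: sqr_ge0.
Qed.

Lemma compact_enorm_ball r : compact [set x : V | enorm x ^+ 2 <= r].
Proof.
have A : compact [set x : V | forall i, `[- (1 + `|r|), 1 + `|r|]%classic (x ord0 i)].
  apply: (@rV_compact R d (fun=> `[- (1 + `|r|), 1 + `|r|]%classic)) => i.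
  exact: segment_compact.
apply: (subclosed_compact _ A).
  rewrite (_ : mkset _ = (fun x : V => enorm x ^+ 2) @^-1` [set t | t <= r])//.
  by apply: closed_comp => [x _|]; [exact: enorm_sqr_continuous|exact: closed_le].
move=> x /= xr i; rewrite in_itv/=.
have := le_trans (sqr_coord_le x i) xr; have := ler_norm r; have := normr_ge0 r.
by move=> r0 rr xi; apply/andP; split; nra.
Qed.

Lemma compactly_supported_vanishes f :
  compactly_supported f -> exists r, vanishes_outside r f.
Proof.
move=> cf.
have : compact ((fun x : V => enorm x ^+ 2) @` closure [set x | f x != 0]).
  apply: continuous_compact => //; apply: continuous_subspaceT.
  exact: enorm_sqr_continuous.
move/compact_bounded => [M [_ MK]]; exists (M + 1) => x Mx; apply/eqP/negPn/negP => fx.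
have : `|enorm x ^+ 2| <= M + 1.
  by apply: (MK (M + 1)); [rewrite ltrDl|exists x => //; exact: subset_closure].
by rewrite ger0_norm ?sqr_ge0// leNgt Mx.
Qed.

Lemma vanishes_compactly_supported r f :
  vanishes_outside r f -> compactly_supported f.
Proof.
move=> rf; have cB := @compact_enorm_ball r.
rewrite /compactly_supported; apply: (subclosed_compact _ cB); first exact: closed_closure.
have clB : closed [set x : V | enorm x ^+ 2 <= r].
  by apply: compact_closed cB.
rewrite ((closure_id _).1 clB); apply: closure_subset => x /= fx.
by rewrite leNgt; apply: contra fx => /rf ->.
Qed.

(** The function $f(x) e^{|x|^2}$ is continuous, hence bounded on [K]. The Gaussian then serves as a
    common integrable majorant. *)
Lemma gauss_bound_compact f (K : set V) : continuous f -> compact K ->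
  exists2 C, 0 <= C & forall x, K x -> `|f x| <= C * expR (- enorm x ^+ 2).
Proof.
move=> cf cK.
pose g := f \* (fun x : V => expR (enorm x ^+ 2)).
have cg : continuous g.
  rewrite /g => x; apply: continuousM; first exact: cf.
  apply: continuous_comp; first exact: enorm_sqr_continuous.
  exact: continuous_expR.
have : compact (g @` K).
  by apply: continuous_compact => //; exact: continuous_subspaceT.
move/compact_bounded => [M [_ MK]]; exists (`|M| + 1) => [|x Kx]; first by rewrite addr_ge0.
have : `|g x| <= `|M| + 1.
  by apply: (MK (`|M| + 1)); [rewrite ltr_pwDr// ler_norm|exists x].
rewrite /g /= normrM (gtr0_norm (expR_gt0 _)) expRN.
by rewrite ler_pdivlMr// expR_gt0.
Qed.

Lemma vanishes_gauss_bound r f : continuous f -> vanishes_outside r f ->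
  exists2 C, 0 <= C & forall x, `|f x| <= C * expR (- enorm x ^+ 2).
Proof.
move=> cf rf; have [C C0 CK] := gauss_bound_compact cf (@compact_enorm_ball r).
exists C => // x; have [xr|/rf ->] := leP (enorm x ^+ 2) r; first exact: CK.
by rewrite normr0 mulr_ge0// expR_ge0.
Qed.

Lemma integrable_gauss_rV (C : R) :
  mu.-integrable setT (fun x => (C * expR (- enorm x ^+ 2))%:E).
Proof.
under eq_fun do rewrite EFinM.
apply: integrableZl => //; apply/integrableP; split; first exact: measurable_gauss_rV.
under eq_integral do rewrite gee0_abs ?lee_fin ?expR_ge0//.
by rewrite integral_gauss_rV ltry.
Qed.

Lemma vanishes_integrable r f : continuous f -> vanishes_outside r f ->
  mu.-integrable setT (EFin \o f).
Proof.
move=> cf rf; have [C C0 fC] := vanishes_gauss_bound cf rf.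
apply: (le_integrable _ _ _ (integrable_gauss_rV C)) => //.
  by apply/measurable_EFinP; exact: continuous_measurable_rV.
by move=> x _ /=; rewrite lee_fin (le_trans (fC x))// ler_norm.
Qed.

Lemma continuous_locally_integrable f : continuous f -> locally_integrable_rV f.
Proof.
move=> cf; split=> [|K cK]; first exact: continuous_measurable_rV.
have mK : measurable K.
  by apply: closed_measurable_rV; apply: compact_closed cK.
have [C C0 fC] := gauss_bound_compact cf cK.
have iK := integrableS measurableT mK (@subsetT _ K) (integrable_gauss_rV C).
apply: (le_integrable _ _ _ iK) => //.
  by apply/measurable_EFinP; apply: measurable_funTS; exact: continuous_measurable_rV.
by move=> x Kx /=; rewrite lee_fin (le_trans (fC _ Kx))// ler_norm.
Qed.

(** Integrating the pointwise bound gives $C \pi^{d/2}$. This one estimate serves both for the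
    finiteness of norms and for the final numerical error. *)
Lemma Lnorm2_le_gauss f (C : R) : continuous f ->
  (forall x, f x ^+ 2 <= C * expR (- enorm x ^+ 2)) ->
  ('N[mu]_2%:E[EFin \o f] <= ((C * Num.sqrt pi ^+ d) `^ 2^-1)%:E)%E.
Proof.
move=> cf fC; have C0 : 0 <= C.
  by rewrite -(pmulr_lge0 _ (expR_gt0 (- enorm (0 : V) ^+ 2))) (le_trans _ (fC 0))// sqr_ge0.
have EC : (\int[mu]_x (C * expR (- enorm x ^+ 2))%:E = (C * Num.sqrt pi ^+ d)%:E)%E.
  under eq_integral do rewrite EFinM.
  rewrite ge0_integralZl// ?integral_gauss_rV//; exact: measurable_gauss_rV.
have Ef x : (`|(EFin \o f) x| `^ 2 = (f x ^+ 2)%:E)%E.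
  by rewrite /= powR_mulrn// real_normK ?num_real.
rewrite unlock /= -poweR_EFin.
have [f0 fle] : (0 <= \int[mu]_x `|(f x)%:E| `^ 2 /\
    \int[mu]_x `|(f x)%:E| `^ 2 <= (C * Num.sqrt pi ^+ d)%:E)%E.
  split; first by apply: integral_ge0 => x _; exact: poweR_ge0.
  rewrite -EC; under eq_integral do rewrite (Ef _).
  apply: ge0_le_integral => //.
  - by move=> x _; rewrite lee_fin sqr_ge0.
  - apply/measurable_EFinP/measurable_funX; exact: continuous_measurable_rV.
  - by have /integrableP[] := integrable_gauss_rV C.
  - by move=> x _; rewrite lee_fin.
apply: gt0_ler_poweR => //.
- by rewrite in_itv/= f0 leey.
- by rewrite in_itv/= (le_trans f0 fle) leey.
Qed.

Lemma partial_vanishes r f i : vanishes_outside r f -> vanishes_outside r (partial i f).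
Proof.
move=> rf x rx.
have oU : open [set y : V | r < enorm y ^+ 2].
  rewrite (_ : mkset _ = (fun x : V => enorm x ^+ 2) @^-1` [set t | r < t])//.
  by apply: open_comp => [y _|]; [exact: enorm_sqr_continuous|exact: open_gt].
rewrite /partial (@near_eq_derive _ _ _ _ (cst 0)) ?derive_cst//.
near=> y; apply: rf; near: y; exact: oU.
Unshelve. all: by end_near. Qed.

Lemma partials_vanishes r f s : vanishes_outside r f -> vanishes_outside r (partials s f).
Proof. by move=> rf; elim: s => //= i s; exact: partial_vanishes. Qed.

End compact_support.

(** * Integration by parts and weak derivatives *)

Section integration_by_parts.
Context {R : realType}.
Implicit Type d : nat.
Local Notation leb := (@lebesgue_measure R).

Lemma cons_rVl_continuous d (y : 'rV[R]_d) : continuous (fun t : R => @cons_rV R d (t, y)).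
Proof.
move=> t; apply/cvg_ballP => e e0; near=> s.
have st : `|t - s| < e by near: s; exact: (@nbhsx_ballx R R t e e0).
rewrite rV_ballE// => i; rewrite !mxE.
by case: unliftP => [j|] _ //; rewrite subrr normr0.
Unshelve. all: by end_near. Qed.

Lemma cons_rVr_continuous d (t : R) : continuous (fun y : 'rV[R]_d => @cons_rV R d (t, y)).
Proof.
move=> y; suff : (fun y : 'rV[R]_d => cons_rV (t, y)) @ nbhs y --> @cons_rV R d (t, y) by [].
apply/cvg_ballP => e e0; near=> z.
have yz : ball y e z by near: z; exact: (@nbhsx_ballx R 'rV[R]_d y e e0).
rewrite rV_ballE// => i; rewrite !mxE.
case: unliftP => [j|] _; last by rewrite subrr normr0.
by move: yz; rewrite rV_ballE// => /(_ j).
Unshelve. all: by end_near. Qed.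

Lemma enorm_cons_rV d (t : R) (y : 'rV[R]_d) :
  enorm (cons_rV (t, y)) ^+ 2 = t ^+ 2 + enorm y ^+ 2.
Proof.
rewrite !enorm_sqr big_ord_recl mxE unlift_none; congr (_ + _).
by apply: eq_bigr => i _; rewrite mxE liftK.
Qed.

Lemma cons_rV_line0 d (s t : R) (y : 'rV[R]_d) :
  cons_rV (s + t, y) = s *: delta_mx ord0 ord0 + cons_rV (t, y).
Proof.
apply/rowP => i; rewrite !mxE eqxx/= [i == _]eq_sym.
case: unliftP => [j ->|->]; first by rewrite -(inj_eq val_inj) mulr0 add0r.
by rewrite eqxx mulr1.
Qed.

Lemma cons_rV_lineS d (s t : R) (y : 'rV[R]_d) j :
  cons_rV (t, s *: delta_mx ord0 j + y) =
  s *: delta_mx ord0 (lift ord0 j) + cons_rV (t, y).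
Proof.
apply/rowP => i; rewrite !mxE eqxx/=.
case: unliftP => [k ->|->]; first by rewrite !mxE eqxx (inj_eq lift_inj).
by rewrite -(inj_eq val_inj) mulr0 add0r.
Qed.

(** Fundamental theorem of calculus on $[-b, b]$ with $b = |r| + 1$: since $b^2 > r$, [F] vanishes
    at both endpoints and [F'] outside the interval. *)
Lemma integral_derive_vanishes (F : R -> R) (F' : R -> R) (r : R) :
  (forall t : R, is_derive t 1 F (F' t)) -> continuous F' ->
  (forall t : R, r < t ^+ 2 -> F t = 0) -> (forall t : R, r < t ^+ 2 -> F' t = 0) ->
  (\int[leb]_t (F' t)%:E = 0)%E.
Proof.
move=> dF cF' F0 F'0; pose b : R := `|r| + 1.
have b0 : 0 < b by rewrite ltr_pwDr.
have rb (t : R) : b <= `|t| -> r < t ^+ 2.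
  move=> bt; rewrite -real_normK ?num_real//.
  have := ler_norm r; have := normr_ge0 r; rewrite /b in b0 bt *; nra.
transitivity (\int[leb]_(t in `[(- b)%R, b]) (F' t)%:E)%E.
  rewrite [RHS]integral_mkcond; apply: eq_integral => t _.
  rewrite patchE; case: ifPn => // /negP tb; rewrite F'0//; apply: rb.
  rewrite leNgt; apply/negP => tb'; apply: tb; rewrite inE/= in_itv/=.
  by rewrite -ler_norml ltW.
have cF : continuous F.
  move=> t; apply: differentiable_continuous.
  by apply/derivable1_diffP; case: (dF t).
rewrite (@continuous_FTC2 _ _ F).
- by rewrite !F0 ?subee//; apply: rb; rewrite ?normrN ger0_norm// ltW.
- by rewrite gtrN.
- exact: continuous_subspaceT.
- split=> [t _||]; first by case: (dF t).
  + by apply: cvg_at_right_filter; exact: cF.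
  + by apply: cvg_at_left_filter; exact: cF.
- by move=> t _; rewrite derive1E; have ? := dF t; rewrite derive_val.
Qed.

(** Induction on the dimension, by Fubini on the first coordinate. The hypotheses concern the single
    direction [i], so they pass to slices. *)
Lemma integral_partial_eq0 d (h : 'rV[R]_d -> R) (i : 'I_d) (r : R) :
  (forall x, derivable h x (delta_mx ord0 i)) -> continuous (partial i h) ->
  vanishes_outside r h ->
  (\int[lebesgue_rV d]_x (partial i h x)%:E = 0)%E.
Proof.
elim: d h i r => [|d IH] h i r dh ch rh; first by case: i dh ch.
have rdh := partial_vanishes i rh.
have idh := vanishes_integrable ch rdh.
rewrite integral_rVS//; have icdh := integrable_rVS idh.
have [j ij|i0] := unliftP ord0 i; last first.
  (* First coordinate: for fixed [y] the integral in [t] is already zero. *)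
  rewrite -(integral21_prod_meas1 icdh); apply: integral0_eq => y _.
  apply: (@integral_derive_vanishes (fun t => h (cons_rV (t, y))) _ r) => [t||t|t].
  - have /is_derive_line D : is_derive (cons_rV (t, y)) (delta_mx ord0 i) h
      (partial i h (cons_rV (t, y))) by exact/derivableP.
    apply/is_derive_line; rewrite [X in is_derive _ _ X _](_ : _ =
      fun s => h (s *: delta_mx ord0 i + cons_rV (t, y)))//.
    by apply/funext => s; rewrite i0 -cons_rV_line0 [s *: 1]mulr1.
  - move=> t; apply: continuous_comp; first exact: cons_rVl_continuous.
    exact: ch.
  - by move=> rt; apply: rh; rewrite enorm_cons_rV ltr_wpDr// sqr_ge0.
  - by move=> rt; apply: rdh; rewrite enorm_cons_rV ltr_wpDr// sqr_ge0.
(* Another coordinate: for fixed [t] the slice in [y] falls under the induction hypothesis. *)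
rewrite -(integral12_prod_meas1 icdh); apply: integral0_eq => t _.
have pD y : is_derive y (delta_mx ord0 j) (fun y => h (cons_rV (t, y)))
    (partial i h (cons_rV (t, y))).
  have /is_derive_line D : is_derive (cons_rV (t, y)) (delta_mx ord0 i) h
    (partial i h (cons_rV (t, y))) by exact/derivableP.
  apply/is_derive_line; rewrite [X in is_derive _ _ X _](_ : _ =
    fun s => h (s *: delta_mx ord0 i + cons_rV (t, y)))//.
  by apply/funext => s; rewrite ij -cons_rV_lineS.
have pE y : partial i h (cons_rV (t, y)) = partial j (fun y => h (cons_rV (t, y))) y.
  by have D := pD y; rewrite [RHS]/partial derive_val.
rewrite /fubini_F; under eq_integral do rewrite /= pE.
apply: (IH _ j r).
- by move=> y; have [] := pD y.
- rewrite (_ : partial _ _ = fun y => partial i h (cons_rV (t, y))).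
    move=> y; apply: continuous_comp; first exact: cons_rVr_continuous.
    exact: ch.
  by apply/funext => y; rewrite pE.
- by move=> y ry; apply: rh; rewrite enorm_cons_rV ltr_wpDl// sqr_ge0.
Qed.

End integration_by_parts.

Section weak_derivative.
Context {R : realType} {d : nat}.
Local Notation V := 'rV[R]_d.
Local Notation mu := (@lebesgue_rV R d).
Implicit Types (f u phi : V -> R) (r : R).

(** The product of [u] and [phi] vanishes where [phi] does, so its partial derivative has integral
    zero; the product rule splits that integral into two integrable terms. *)
Lemma integral_partialM u phi i r : Ck 1 u -> Ck 1 phi -> vanishes_outside r phi ->
  (\int[mu]_x (u x * partial i phi x)%:E = - \int[mu]_x (partial i u x * phi x)%:E)%E.
Proof.
move=> Cu Cphi rphi.
have [/CkS[cu du Cdu] /CkS[cphi dphi Cdphi]] := (Cu, Cphi).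
have pM x : partial i (fun x => u x * phi x) x = u x * partial i phi x + partial i u x * phi x.
  by rewrite {1}/partial deriveM// [phi x *: _]mulrC.
have i1 : mu.-integrable setT (fun x => (u x * partial i phi x)%:E).
  apply: (@vanishes_integrable _ _ r) => [x|x rx]; last first.
    by rewrite (partial_vanishes i rphi) ?mulr0.
  by apply: continuousM; [exact: cu|exact: Ck_continuous (Cdphi i) _].
have i2 : mu.-integrable setT (fun x => (partial i u x * phi x)%:E).
  apply: (@vanishes_integrable _ _ r) => [x|x rx]; last by rewrite rphi ?mulr0.
  by apply: continuousM; [exact: Ck_continuous (Cdu i) _|exact: cphi].
have C1 := Ck_mul Cu Cphi; have /CkS[_ dup Cdup] := C1.
have r1 : vanishes_outside r (fun x => u x * phi x) by move=> x rx; rewrite rphi ?mulr0.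
have := integral_partial_eq0 (dup i) (Ck_continuous (Cdup i)) r1.
under eq_integral do rewrite pM EFinD.
have f1 := integrable_fin_num measurableT i1.
have f2 := integrable_fin_num measurableT i2.
rewrite integralD// -(fineK f1) -(fineK f2) -EFinD -EFinN => -[ab]; congr (_%:E).
by apply/eqP; rewrite -addr_eq0 ab.
Qed.

(** Derivatives leave [phi] outermost first and the first one to arrive on [u] is innermost there,
    whence [rev s]. The symmetry of mixed derivatives is thereby avoided. *)
Lemma integral_partials k u phi s r : Ck k u -> (forall m, Ck m phi) ->
  vanishes_outside r phi -> (size s <= k)%N ->
  (\int[mu]_x (u x * partials s phi x)%:E =
   ((-1) ^+ size s)%:E * \int[mu]_x (partials (rev s) u x * phi x)%:E)%E.
Proof.
elim: s k u => [|i s IH] k u Cu Cphi rphi; first by rewrite /= mul1e.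
case: k Cu => // k Cu sk; have /CkS[_ _ Cdu] := Cu.
have Cs m : Ck m (partials s phi).
  elim: (s) m => [|j t IHt] m; first exact: Cphi.
  by have /CkS[_ _ /(_ j)] := IHt m.+1.
rewrite (integral_partialM i (Ck_leq _ Cu) (Cs 1%N) (partials_vanishes s rphi))//.
rewrite (IH k _ (Cdu i) Cphi rphi sk).
by rewrite rev_cons partials_rcons exprS mulN1r EFinN mulNe.
Qed.

Definition mindex_seq k (b : mindex d k) : seq 'I_d :=
  flatten [seq nseq (b i) i | i <- enum 'I_d].

Lemma size_mindex_seq k (b : mindex d k) : size (mindex_seq b) = mdeg b.
Proof.
rewrite size_flatten /shape -map_comp sumnE big_map /mdeg big_enum /=.
by apply: eq_bigr => i _; rewrite /= size_nseq.
Qed.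

Lemma Ck_weak_mpartial m k (b : mindex d k) u : Ck m u -> (mdeg b <= m)%N ->
  weak_mpartial b u (partials (rev (mindex_seq b)) u).
Proof.
move=> Cu; rewrite -size_mindex_seq => bm; split.
- exact/continuous_locally_integrable/(Ck_continuous Cu).
- by apply: continuous_locally_integrable; case: (Cu (rev (mindex_seq b))); rewrite ?size_rev.
- move=> phi [Cphi /compactly_supported_vanishes[r rphi]].
  by rewrite -size_mindex_seq; exact: (integral_partials Cu Cphi rphi bm).
Qed.

Lemma monomial_continuous k (a : mindex d k) : continuous (@monomial R d k a).
Proof.
apply: continuous_big => [|i _ x]; first exact: mul_continuous.
apply: (@continuous_comp _ _ _ (fun x : V => x ord0 i) (fun t => t ^+ a i)).
  exact: coord_continuous.
exact: exprn_continuous.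
Qed.

(** Each infimum is at most its value at the classical derivative, and a monomial times that
    derivative is continuous and vanishes outside a ball, so its $L^2$ norm is finite. *)
Lemma Bnorm_lty f r : Ck 2 f -> vanishes_outside r f -> (Bnorm f < +oo)%E.
Proof.
move=> Cf rf; apply: poweR_lty; apply: lte_sum_pinfty => -[a b] /= /eqP ab.
have b2 : (mdeg b <= 2)%N by apply: (leq_trans (leq_addl (mdeg a) _)); rewrite ab.
pose v := partials (rev (mindex_seq b)) f.
have cv : continuous v by case: (Cf (rev (mindex_seq b))); rewrite ?size_rev ?size_mindex_seq.
pose w := @monomial R d 2 a \* v.
have cw : continuous w.
  by rewrite /w => x; apply: continuousM; [exact: monomial_continuous|exact: cv].
have rv : vanishes_outside r v by exact: partials_vanishes.
(* The bound is taken on the square of [w], the form that [Lnorm2_le_gauss] expects. *)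
have [C C0 wC] : exists2 C, 0 <= C & forall x, `|(w \* w) x| <= C * expR (- enorm x ^+ 2).
  apply: (@vanishes_gauss_bound _ _ r) => [x|x rx]; last by rewrite /w /= rv// !mulr0.
  by apply: continuousM; exact: cw.
have : (Lnorm_monomial_D a b f <= 'N[mu]_2%:E[EFin \o w])%E.
  by apply: ereal_inf_lbound; exists v => //; exact: Ck_weak_mpartial b2.
have w2 x : w x ^+ 2 <= C * expR (- enorm x ^+ 2).
  by rewrite expr2 (le_trans (ler_norm _) (wC x)).
move=> /le_trans /(_ (Lnorm2_le_gauss cw w2)) le.
(* The lower bound excludes the value $-\infty$ for the infimum. *)
have ge0 : (0 <= Lnorm_monomial_D a b f)%E.
  by apply: le_ereal_inf_tmp => _ [z _ <-]; exact: Lnorm_ge0.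
have fin : (Lnorm_monomial_D a b f \is a fin_num)%E.
  by rewrite ge0_fin_numE// (le_lt_trans le)// ltry.
by rewrite ltey_eq fin_numM.
Qed.

End weak_derivative.

(** * Positive Gaussian sums close to 1 *)

Section cosh.
Context {R : realType}.
Implicit Types s t : R.

(** By the mean value theorem. The inequalities on [cosh] and [sinh] follow by differentiating the
    difference of the two sides, with no power series. *)
Lemma derive_ge0 (F F' : R -> R) :
  (forall t : R, is_derive t 1 F (F' t)) -> (forall t : R, 0 <= t -> 0 <= F' t) ->
  F 0 = 0 -> forall t : R, 0 <= t -> 0 <= F t.
Proof.
move=> dF F'0 F0 t; rewrite le_eqVlt => /predU1P[<-|t0]; first by rewrite F0.
have cF : continuous F.
  move=> s; apply: differentiable_continuous.
  by apply/derivable1_diffP; case: (dF s).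
have [c] := MVT t0 (fun s _ => dF s) (continuous_subspaceT cF).
rewrite in_itv/= F0 !subr0 => /andP[c0 _] ->.
by rewrite mulr_ge0 ?F'0// ltW.
Qed.

Definition cosh s : R := (expR s + expR (- s)) / 2.
Definition sinh s : R := (expR s - expR (- s)) / 2.

Lemma is_derive_expRN s : is_derive s 1 (fun s => expR (- s)) (- expR (- s)).
Proof.
have := @is_derive1_comp _ expR -%R s _ _ (is_derive_expR (- s)) (is_deriveNid s 1).
by rewrite mulrN1.
Qed.

Lemma is_derive_cosh s : is_derive s 1 cosh (sinh s).
Proof.
have ? := is_derive_expRN s; have ? := is_derive_expR s.
rewrite /cosh; apply: is_derive_eq.
by rewrite /GRing.scale/= /sinh; field.
Qed.

Lemma is_derive_sinh s : is_derive s 1 sinh (cosh s).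
Proof.
have ? := is_derive_expRN s; have ? := is_derive_expR s.
rewrite /sinh; apply: is_derive_eq.
by rewrite /GRing.scale/= /cosh; field.
Qed.

Lemma coshN s : cosh (- s) = cosh s.
Proof. by rewrite /cosh opprK addrC. Qed.

Lemma cosh_ge1 s : 1 <= cosh s.
Proof. by rewrite /cosh; have := expR_ge1Dx s; have := expR_ge1Dx (- s); lra. Qed.

Lemma sinh_ge_id s : 0 <= s -> s <= sinh s.
Proof.
move=> s0; rewrite -subr_ge0.
apply: (@derive_ge0 (fun s => sinh s - s) (fun s => cosh s - 1)) s0.
- by move=> t; have ? := is_derive_sinh t; exact: is_deriveB.
- by move=> t _; rewrite subr_ge0 cosh_ge1.
- by rewrite /sinh subr0 oppr0 subrr mul0r.
Qed.

(** Evenness reduces to $s \ge 0$, where the derivative of the difference is $\sinh s - s \ge 0$. *)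
Lemma cosh_ge s : 1 + s ^+ 2 / 2 <= cosh s.
Proof.
wlog s0 : s / 0 <= s => [H|].
  by have [/H//|/ltW s0] := leP 0 s; rewrite -coshN -sqrrN; apply: H; rewrite oppr_ge0.
rewrite -subr_ge0.
apply: (@derive_ge0 (fun s => cosh s - (1 + s ^+ 2 / 2)) (fun s => sinh s - s)) s0.
- move=> t; have ? := is_derive_cosh t; apply: is_derive_eq.
  by rewrite /GRing.scale/=; field.
- by move=> t t0; rewrite subr_ge0 sinh_ge_id.
- by rewrite /cosh oppr0 expR0; field.
Qed.

Lemma sinh_le s : 0 <= s -> sinh s <= s * cosh s.
Proof.
move=> s0; rewrite -subr_ge0.
apply: (@derive_ge0 (fun s => s * cosh s - sinh s) (fun s => s * sinh s)) s0.
- move=> t; have ? := is_derive_cosh t; have ? := is_derive_sinh t; apply: is_derive_eq.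
  by rewrite /GRing.scale/=; ring.
- by move=> t t0; rewrite mulr_ge0// (le_trans t0)// sinh_ge_id.
- by rewrite /sinh oppr0 mul0r subrr mul0r subr0.
Qed.

Definition cosh_gauss s := expR (- (s ^+ 2 / 2)) * cosh s.

(** For $s \ge 0$ the derivative of $1 - e^{-s^2/2}\cosh s$ is $e^{-s^2/2}(s\cosh s - \sinh s)$,
    nonnegative by [sinh_le]. *)
Lemma cosh_gauss_itv s : 0 <= cosh_gauss s <= 1.
Proof.
have c0 t : 0 <= cosh t by rewrite (le_trans _ (cosh_ge1 t)).
rewrite mulr_ge0 ?expR_ge0//=.
wlog s0 : s / 0 <= s => [H|].
  have [/H//|/ltW s0] := leP 0 s; rewrite /cosh_gauss -coshN -sqrrN.
  by apply: H; rewrite oppr_ge0.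
rewrite -subr_ge0; apply: (@derive_ge0 (fun s => 1 - cosh_gauss s)
  (fun s => expR (- (s ^+ 2 / 2)) * (s * cosh s - sinh s))) s0.
- move=> t; have ? := is_derive_cosh t.
  have ? : is_derive t 1 (fun s => expR (- (s ^+ 2 / 2))) (expR (- (t ^+ 2 / 2)) * - t).
    apply: (@is_derive1_comp _ expR (fun s => - (s ^+ 2 / 2))); apply: is_derive_eq.
    by rewrite /GRing.scale/=; field.
  rewrite /cosh_gauss; apply: is_derive_eq.
  by rewrite /GRing.scale/=; ring.
- by move=> t t0; rewrite mulr_ge0 ?expR_ge0// subr_ge0 sinh_le.
- by rewrite /cosh_gauss /cosh expr0n/= mul0r oppr0 expR0; field.
Qed.

(** With $y = s^2$, the bounds $e^{-y/2} \ge 1 - y/2$ and $\cosh s \ge 1 + y/2$ multiply to $1 -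
    y^2/4$. *)
Lemma cosh_gauss_ge s : 1 - cosh_gauss s <= s ^+ 4 / 4.
Proof.
have := cosh_ge s; have := expR_ge1Dx (- (s ^+ 2 / 2)).
have := expR_ge0 (- (s ^+ 2 / 2)); rewrite /cosh_gauss.
set e := expR _; set c := cosh s; have -> : s ^+ 4 = s ^+ 2 * s ^+ 2 by ring.
have := sqr_ge0 s; set y := s ^+ 2 => y0 e0 ey cy.
have : e * (1 + y / 2) <= e * c by rewrite ler_wpM2l.
nra.
Qed.

End cosh.

(** The Weierstrass product inequality: the defects from 1 at most add up. *)
Lemma prod_ge1B (R : realType) (I : Type) (r : seq I) (u : I -> R) :
  (forall i, 0 <= u i <= 1) ->
  1 - \sum_(i <- r) (1 - u i) <= \prod_(i <- r) u i <= 1.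
Proof.
move=> u01.
have p0 s : 0 <= \prod_(i <- s) u i by apply: prodr_ge0 => i _; case/andP: (u01 i).
elim: r => [|i r /andP[IH1 IH2]]; first by rewrite !big_nil subr0 lexx.
rewrite !big_cons; have /andP[i0 i1] := u01 i; have := p0 r.
by set p := \prod_(_ <- _) _ in IH1 IH2 * => pr0; apply/andP; split; nra.
Qed.

(** * Positive sums of exponentials and their Gaussian form *)

Section exp_sum.
Context {R : realType} {d : nat}.
Local Notation V := 'rV[R]_d.
Implicit Types (h : V -> R) (s : seq (R * V)) (x b : V).

Definition dot b x : R := \sum_(i < d) b ord0 i * x ord0 i.

(** The list is nonempty because all weights of a Gaussian sum must be positive, so the zero
    function cannot be reached. *)
Definition exp_sum h := exists s,
  [/\ s != [::], all (fun p => 0 < p.1) s &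
      forall x, h x = \sum_(p <- s) p.1 * expR (dot p.2 x)].

Lemma exp_sum1 : exp_sum (fun=> 1).
Proof.
exists [:: (1, 0)]; split=> [//||x] /=; first by rewrite ltr01.
by rewrite big_seq1 /dot big1 ?expR0 ?mulr1// => i _; rewrite mxE mul0r.
Qed.

Lemma exp_sumM h1 h2 : exp_sum h1 -> exp_sum h2 -> exp_sum (fun x => h1 x * h2 x).
Proof.
move=> [s [s0 sp sE]] [t [t0 tp tE]].
exists [seq (p.1 * q.1, p.2 + q.2) | p <- s, q <- t]; split.
- by rewrite -size_eq0 size_allpairs muln_eq0 !size_eq0 negb_or s0.
- apply/allP => _ /allpairsP[[p q] [ps qt ->]] /=.
  by rewrite mulr_gt0//; [exact: (allP sp _ ps)|exact: (allP tp _ qt)].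
- move=> x; rewrite sE tE big_allpairs_dep mulr_suml; apply: eq_bigr => p _.
  rewrite mulr_sumr; apply: eq_bigr => q _ /=; rewrite mulrACA -expRD; congr (_ * expR _).
  by rewrite /dot -big_split; apply: eq_bigr => i _; rewrite mxE mulrDl.
Qed.

Lemma exp_sumX h n : exp_sum h -> exp_sum (fun x => h x ^+ n).
Proof.
move=> hh; elim: n => [|n IH]; first exact: exp_sum1.
by under eq_fun do rewrite exprS; exact: exp_sumM.
Qed.

Lemma exp_sum_prod (I : Type) (r : seq I) (F : I -> V -> R) :
  (forall i, exp_sum (F i)) -> exp_sum (fun x => \prod_(i <- r) F i x).
Proof.
move=> FE; elim: r => [|i r IH].
  by under eq_fun do rewrite big_nil; exact: exp_sum1.
by under eq_fun do rewrite big_cons; exact: exp_sumM.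
Qed.

Lemma exp_sum_cosh (c : R) (i : 'I_d) : exp_sum (fun x => cosh (c * x ord0 i)).
Proof.
have dotE (a : R) x : dot (a *: delta_mx ord0 i) x = a * x ord0 i.
  rewrite /dot (bigD1 i)//= big1 ?addr0 => [|j /negbTE ji].
    by rewrite !mxE !eqxx mulr1.
  by rewrite !mxE ji andbF mulr0 mul0r.
exists [:: (2^-1, c *: delta_mx ord0 i); (2^-1, (- c) *: delta_mx ord0 i)].
split=> [//| |x]; first by rewrite /= !andbT andbb invr_gt0.
by rewrite !big_cons big_nil /= !dotE addr0 mulNr /cosh; field.
Qed.

Lemma exp_sum_Ck k h : exp_sum h -> Ck k h.
Proof.
move=> [s [_ _ hE]]; rewrite (_ : h = fun x => \sum_(p <- s) p.1 * expR (dot p.2 x)).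
  apply: Ck_sum => p; apply: Ck_mul; first exact: Ck_cst.
  apply: (Ck_comp (@Ck1_expR R k)); apply: Ck_sum => i.
  by apply: Ck_mul; [exact: Ck_cst|exact: Ck_coord].
exact/funext.
Qed.

(** Completing the square, $b_i x_i \le b_i^2 + x_i^2/4$ in each coordinate. The factor $1/4$ keeps
    the growth well below the decay of the Gaussian. *)
Lemma exp_sum_le h : exp_sum h ->
  exists2 C, 0 <= C & forall x, h x <= C * expR (enorm x ^+ 2 / 4).
Proof.
move=> [s [_ sp hE]].
exists (\sum_(p <- s) p.1 * expR (enorm p.2 ^+ 2)) => [|x].
  rewrite big_seq; apply: sumr_ge0 => p ps.
  by rewrite mulr_ge0 ?expR_ge0// ltW//; exact: (allP sp _ ps).
rewrite hE mulr_suml big_seq [leRHS]big_seq; apply: ler_sum => p ps.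
rewrite -mulrA -expRD ler_wpM2l ?(ltW (allP sp _ ps))// ler_expR /dot !enorm_sqr.
rewrite mulr_suml -big_split; apply: ler_sum => i _ /=.
by have := sqr_ge0 (p.2 ord0 i - x ord0 i / 2); nra.
Qed.

(* The nodes are listed along the first entry of the multi-index, the last one
   being repeated; the weight of a node is shared equally between the
   multi-indices that give it. *)
Lemma exp_sum_gaussian_sum h : (0 < d)%N -> exp_sum h ->
  exists N : nat, (2 < N)%N /\
  exists (a : mindex d N -> V) (c : mindex d N -> R),
    (forall n, 0 < c n) /\
    forall x, gaussian_sum c a x = expR (- enorm x ^+ 2) * h x.
Proof.
move=> d_gt0 [[[]//|p0 s']]; pose i0 : 'I_d := Ordinal d_gt0.
set s := p0 :: s'; set L := size s' => -[_ /allP sp hE].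
(* The nodes are numbered from 0 to [L]; adding 3 secures [2 < N] even for a single node. *)
exists L.+3; split=> //.
pose node (n : mindex d L.+3) : 'I_L.+1 := inord (minn (n i0) L).
pose fib j := [pred n : mindex d L.+3 | (mdeg n <= L.+3)%N && (node n == j)].
(* The multi-index with first entry [j] and zeros elsewhere has degree at most [L], so every node is
   reached. *)
have fib0 j : (0 < #|fib j|)%N.
  pose n : mindex d L.+3 := [ffun i => if i == i0 then inord j else ord0].
  have n0 : n i0 = j :> nat.
    by rewrite ffunE eqxx inordK//; have := ltn_ord j; lia.
  apply/card_gt0P; exists n; rewrite inE; apply/andP; split.
    rewrite /mdeg (bigD1 i0)//= n0 big1 ?addn0 => [|i /negbTE ii0]; last by rewrite ffunE ii0.
    by have := ltn_ord j; lia.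
  by apply/eqP/val_inj; rewrite /node n0 (minn_idPl _) ?inord_val// -ltnS ltn_ord.
pose P j := nth p0 s j.
have Ppos (j : 'I_L.+1) : 0 < (P j).1 by apply: sp; rewrite mem_nth.
(* From $b \cdot x - |x|^2 = |b|^2/4 - |x - b/2|^2$: the translation is $-b/2$ and the weight gains
   $e^{|b|^2/4}$. *)
exists (fun n => - (2^-1 *: (P (node n)).2)).
exists (fun n => (P (node n)).1 * expR (enorm (P (node n)).2 ^+ 2 / 4) / #|fib (node n)|%:R).
split=> [n|x].
  by rewrite divr_gt0 ?mulr_gt0 ?expR_gt0 ?ltr0n.
(* Grouped by node, the terms of a fibre are equal, and their number cancels the division by its
   cardinal. *)
rewrite hE /gaussian_sum (partition_big node xpredT)//=.
rewrite (big_nth p0) big_mkord mulr_sumr; apply: eq_bigr => j _.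
rewrite (eq_bigr (fun=>
    expR (- enorm x ^+ 2) * ((P j).1 * expR (dot (P j).2 x)) / #|fib j|%:R)).
  rewrite sumr_const (@eq_card _ _ (fib j))// -[_ *+ _]mulr_natr divfK//.
  by rewrite pnatr_eq0 -lt0n fib0.
move=> n /andP[_ /eqP ->].
rewrite mulrAC; congr (_ / _).
rewrite mulrCA -mulrA; congr (_ * _); rewrite -!expRD; congr expR.
rewrite /dot !enorm_sqr mulr_suml -!sumrN -!big_split; apply: eq_bigr => i _ /=.
by rewrite !mxE; field.
Qed.

End exp_sum.

(** * Uniform approximation of 1 on bounded sets *)

Section approximation.
Context {R : realType} {d : nat}.
Local Notation V := 'rV[R]_d.
Local Notation mu := (@lebesgue_rV R d).

(** The exponent makes $(e^{-s^2/2})^{2m^2} = e^{-x_i^2}$ for $s = x_i/m$ with $m > 0$, so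
    multiplying by the Gaussian gives a product of powers of [cosh_gauss]. *)
Definition cosh_prod (m : nat) (x : V) : R :=
  \prod_(i < d) cosh (m%:R^-1 * x ord0 i) ^+ (2 * m ^ 2).

Lemma exp_sum_cosh_prod m : exp_sum (cosh_prod m).
Proof. by apply: exp_sum_prod => i; apply: exp_sumX; exact: exp_sum_cosh. Qed.

(** The product inequality for [k] equal factors, that is, Bernoulli's inequality. *)
Lemma cosh_gauss_exp_ge1B (s : R) k :
  1 - cosh_gauss s ^+ k <= s ^+ 4 / 4 *+ k /\ 0 <= cosh_gauss s ^+ k <= 1.
Proof.
have s01 := cosh_gauss_itv s.
have /andP[] := @prod_ge1B R 'I_k (index_enum 'I_k) (fun=> cosh_gauss s) (fun=> s01).
rewrite sumr_const prodr_const card_ord => s1 s2; split.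
  rewrite lerBlDl -lerBlDr (le_trans _ s1)// lerB// lerMn2r cosh_gauss_ge orbT//.
by rewrite s2 exprn_ge0//; case/andP: s01.
Qed.

Lemma cosh_prod_gauss_itv m x : (0 < m)%N ->
  1 - enorm x ^+ 4 / (2 * m%:R ^+ 2) <= expR (- enorm x ^+ 2) * cosh_prod m x <= 1.
Proof.
move=> m0; set k := (2 * m ^ 2)%N; set s := fun i => m%:R^-1 * x ord0 i.
have m0' : m%:R != 0 :> R by rewrite pnatr_eq0 -lt0n.
have -> : expR (- enorm x ^+ 2) * cosh_prod m x = \prod_(i < d) cosh_gauss (s i) ^+ k.
  rewrite enorm_sqr -sumrN expR_sum /cosh_prod -big_split; apply: eq_bigr => i _ /=.
  rewrite /cosh_gauss [RHS]exprMn -expRM_natl; congr (expR _ * _).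
  by rewrite /s /k natrM natrX; field.
have /andP[L U] := @prod_ge1B R 'I_d (index_enum 'I_d) (fun i => cosh_gauss (s i) ^+ k)
  (fun i => (cosh_gauss_exp_ge1B (s i) k).2).
rewrite U andbT (le_trans _ L)// lerB//.
(* Each coordinate contributes at most $2m^2 (x_i/m)^4/4 = x_i^4/(2m^2)$; then $\sum_i x_i^4 \le
   |x|^4$. *)
apply: (@le_trans _ _ (\sum_(i < d) x ord0 i ^+ 4 / (2 * m%:R ^+ 2))).
  apply: ler_sum => i _; rewrite (le_trans (cosh_gauss_exp_ge1B (s i) k).1)//.
  by rewrite /s /k -mulr_natr natrM natrX; rewrite le_eqVlt; apply/predU1P; left; field.
rewrite -mulr_suml ler_wpM2r ?invr_ge0 ?mulr_ge0//.
rewrite (_ : enorm x ^+ 4 = enorm x ^+ 2 * enorm x ^+ 2); last by rewrite -exprD.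
rewrite [X in _ <= X * _]enorm_sqr mulr_suml; apply: ler_sum => i _.
rewrite (_ : x ord0 i ^+ 4 = x ord0 i ^+ 2 * x ord0 i ^+ 2); last by rewrite -exprD.
by rewrite ler_wpM2l ?sqr_ge0// sqr_coord_le.
Qed.

End approximation.

(** * Gluing 1, the Gaussian sum and 0 across spherical shells *)

Section bump.
Context {R : realType} {d : nat}.
Local Notation V := 'rV[R]_d.
Local Notation mu := (@lebesgue_rV R d).
Variables (r n : R) (g : V -> R).

(* [r] and [n] are squared radii. *)
Definition glued (x : V) : R :=
  cutoff (enorm x ^+ 2 - r) +
  (1 - cutoff (enorm x ^+ 2 - r)) * (cutoff (enorm x ^+ 2 - n) * g x).

Lemma glued1 x : enorm x ^+ 2 <= r -> glued x = 1.
Proof. by move=> xr; rewrite /glued cutoff1 ?subr_le0// subrr mul0r addr0. Qed.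

Lemma glued_vanishes : r + 1 <= n -> vanishes_outside (n + 1) glued.
Proof.
move=> rn x nx; rewrite /glued !cutoff0 ?mul0r ?mulr0 ?addr0//; lra.
Qed.

Lemma Ck_enorm_sqr k : Ck k (fun x : V => enorm x ^+ 2).
Proof.
rewrite (_ : (fun _ => _) = fun x : V => \sum_(i < d) x ord0 i * x ord0 i).
  by apply: Ck_sum => i; apply: Ck_mul; exact: Ck_coord.
by apply/funext => x; rewrite enorm_sqr; apply: eq_bigr => i _; rewrite expr2.
Qed.

Lemma Ck_glued : Ck 2 g -> Ck 2 glued.
Proof.
move=> Cg.
have Cc c : Ck 2 (fun x : V => cutoff (enorm x ^+ 2 - c)).
  apply: Ck_cutoff; apply: Ck_add; [exact: Ck_enorm_sqr|exact: Ck_cst].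
rewrite (_ : glued = fun x => cutoff (enorm x ^+ 2 - r) +
  (1 + (-1) * cutoff (enorm x ^+ 2 - r)) * (cutoff (enorm x ^+ 2 - n) * g x)).
  apply: Ck_add; first exact: Cc.
  apply: Ck_mul; last by apply: Ck_mul; [exact: Cc|].
  by apply: Ck_add; [exact: Ck_cst|apply: Ck_mul; [exact: Ck_cst|exact: Cc]].
by apply/funext => x; rewrite /glued mulN1r.
Qed.

(** The two transitions do not overlap. Up to squared radius [n] the difference is $p(1 - g)$, with
    $p = 0$ beyond [r + 1]; past [n] it is $(c - 1) g$. Both cutoffs lie in $[0, 1]$. *)
Lemma glued_dist (eps : R) x : 0 <= eps -> r + 1 <= n ->
  (enorm x ^+ 2 <= r + 1 -> (1 - g x) ^+ 2 <= eps) ->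
  (n <= enorm x ^+ 2 -> g x ^+ 2 <= eps) ->
  (glued x - g x) ^+ 2 <= eps.
Proof.
move=> eps0 rn near far; rewrite /glued.
have /andP[p0 p1] := cutoff_itv (enorm x ^+ 2 - r).
have /andP[c0 c1] := cutoff_itv (enorm x ^+ 2 - n).
have [xn|xn] := leP (enorm x ^+ 2) n.
  rewrite [cutoff (_ - n)]cutoff1 ?subr_le0// mul1r.
  have [xr|xr] := leP (enorm x ^+ 2) (r + 1).
    have := near xr; have := sqr_ge0 (1 - g x); set p := cutoff _ in p0 p1 *.
    move=> g0 ge; rewrite (_ : _ - _ = p * (1 - g x)); last by ring.
    by rewrite exprMn (le_trans _ ge)// ler_piMl// exprn_ile1.
  by rewrite cutoff0 ?subr0 ?mul1r ?add0r ?subrr ?expr0n//; lra.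
rewrite [cutoff (_ - r)]cutoff0; last by lra.
have := far (ltW xn); have := sqr_ge0 (g x); set c := cutoff _ in c0 c1 *.
move=> g0 ge; rewrite (_ : _ - _ = (c - 1) * g x); last by ring.
rewrite exprMn (le_trans _ ge)// ler_piMl//; nra.
Qed.

End bump.

(** The square equals $C^2 e^{-q/2} e^{-q}$, and $e^{q/2} \ge 1 + q/2 \ge C^2/\epsilon$ by the
    choice of [n]. *)
Lemma gauss_tail_le (R : realType) (C n eps q : R) : 0 < eps -> 0 <= n ->
  2 * C ^+ 2 / eps <= n -> n <= q ->
  (expR (- q) * (C * expR (q / 4))) ^+ 2 <= eps * expR (- q).
Proof.
move=> eps0 n0 Cn nq.
have -> : (expR (- q) * (C * expR (q / 4))) ^+ 2 = C ^+ 2 * expR (- (q / 2)) * expR (- q).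
  by rewrite mulrCA exprMn -expRD -mulrA -expRD -expRM_natl; congr (_ * expR _); field.
rewrite ler_wpM2r ?expR_ge0// expRN ler_pdivrMr ?expR_gt0//.
have := expR_ge1Dx (q / 2); move: Cn; rewrite ler_pdivrMr//.
set e := expR _ => Cn eq; have : eps * (1 + q / 2) <= eps * e by rewrite ler_pM2l.
by move=> ee; rewrite (le_trans _ ee)//; nra.
Qed.

(** As $m \ge 1$, the bound on [v] gives $vm \le A^2$, so $v^2 m \le (vm)^2 \le A^4$; multiplying by
    [e] and dividing by [m] concludes. *)
Lemma near_error_le (R : realType) (m : nat) (A q v e eps : R) :
  (0 < m)%N -> 0 < e -> 0 < eps -> A ^+ 4 * e / eps <= m%:R -> 0 <= q <= A ->
  0 <= v <= q ^+ 2 / (2 * m%:R ^+ 2) -> v ^+ 2 * e <= eps.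
Proof.
move=> m0 e0 eps0; have : 1 <= m%:R :> R by rewrite ler1n.
move: (m%:R : R) => y y1; rewrite ler_pdivrMr// => Ae /andP[q0 qA].
rewrite ler_pdivlMr; last by nra.
move=> /andP[v0 vq]; have vy : v * y <= A ^+ 2.
  have : q ^+ 2 <= A ^+ 2 by rewrite ler_pXn2r// nnegrE// (le_trans q0).
  nra.
have vy2 : (v * y) ^+ 2 <= (A ^+ 2) ^+ 2 by rewrite ler_pXn2r// nnegrE; nra.
have y0 : 0 < y by lra.
rewrite -(ler_pM2l y0) (le_trans _ Ae)// mulrA ler_pM2r//.
rewrite (_ : A ^+ 4 = (A ^+ 2) ^+ 2); last by rewrite -exprM.
by rewrite (le_trans _ vy2)// exprMn; have := sqr_ge0 v; nra.
Qed.

Theorem lemma3 (R : realType) (d : nat) (d_gt0 : (0 < d)%N)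
    (M : R) (M_ge2 : 2 <= M) :
  exists f : 'rV[R]_d -> R,
    [/\ piecewise_C1 f,
        compactly_supported f,
        forall x : 'rV[R]_d, enorm x < M / 2 -> f x = 1 &
        exists eta : R, classA_for eta f].
Proof.
pose r : R := (M / 2) ^+ 2; have r0 : 0 <= r by rewrite sqr_ge0.
pose I : R := Num.sqrt pi ^+ d.
have I0 : 0 < I by rewrite exprn_gt0// sqrtr_gt0 pi_gt0.
(* [I] is the integral of the Gaussian, so a squared error below $\epsilon e^{-|x|^2}$ integrates to
   at most $1/4$, whence $\eta = 1/2$. *)
pose eps : R := (4 * I)^-1; have eps0 : 0 < eps by rewrite invr_gt0 mulr_gt0.
(* The threshold of [near_error_le] for $A = r + 1$ and $e = e^{r+1}$; the successor also makes [m]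
   positive. *)
pose m := (Num.trunc ((r + 1) ^+ 4 * expR (r + 1) / eps)).+1.
have mgt : (r + 1) ^+ 4 * expR (r + 1) / eps <= m%:R.
  exact/ltW/truncnS_gt.
have [C C0 hC] := exp_sum_le (@exp_sum_cosh_prod R d m).
pose g x : R := expR (- enorm x ^+ 2) * @cosh_prod R d m x.
(* The term [r + 1] separates the two transitions, the other one is the threshold of
   [gauss_tail_le]. *)
pose n : R := r + 1 + 2 * C ^+ 2 / eps.
have Ce0 : 0 <= 2 * C ^+ 2 / eps by rewrite divr_ge0 ?mulr_ge0 ?sqr_ge0 ?(ltW eps0).
have rn : r + 1 <= n by rewrite lerDl.
have Cg : Ck 2 g.
  apply: Ck_mul; last exact/exp_sum_Ck/exp_sum_cosh_prod.
  apply: (Ck_comp (@Ck1_expR R 2)).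
  rewrite (_ : (fun _ => _) = fun x => (-1) * enorm x ^+ 2).
    by apply: Ck_mul; [exact: Ck_cst|exact: Ck_enorm_sqr].
  by apply/funext => x; rewrite mulN1r.
pose f := glued r n g.
have Cf : Ck 2 f := Ck_glued r n Cg.
have fn : vanishes_outside (n + 1) f := glued_vanishes g rn.
have cf := Ck_continuous Cf.
have fg x : (f x - g x) ^+ 2 <= eps * expR (- enorm x ^+ 2).
  apply: glued_dist => //; first by rewrite mulr_ge0 ?expR_ge0 ?(ltW eps0).
    (* On this ball the Gaussian is at least $e^{-(r+1)}$, so a constant bound suffices. *)
    move=> xr; rewrite (@le_trans _ _ (eps * expR (- (r + 1))))//; last first.
      by rewrite ler_pM2l// ler_expR lerN2.
    rewrite expRN ler_pdivlMr ?expR_gt0//.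
    have /andP[gl gu] := cosh_prod_gauss_itv x (ltn0Sn _ : 0 < m)%N.
    apply: (near_error_le (q := enorm x ^+ 2) (ltn0Sn _) (expR_gt0 _) eps0 mgt).
      by rewrite sqr_ge0.
    by rewrite subr_ge0 gu/= -exprM lerBlDr -lerBlDl.
  have n0 : 0 <= n by rewrite (le_trans _ rn)// addr_ge0.
  have Cn : 2 * C ^+ 2 / eps <= n by rewrite lerDr addr_ge0.
  move=> nx; apply: le_trans (gauss_tail_le eps0 n0 Cn nx).
  have g0 : 0 <= cosh_prod m x.
    by apply: prodr_ge0 => i _; rewrite exprn_ge0// (le_trans _ (cosh_ge1 _)).
  rewrite lerXn2r ?nnegrE ?mulr_ge0 ?expR_ge0//.
  by rewrite ler_wpM2l ?expR_ge0.
have [N [N2 [a [c [c0 gE]]]]] := exp_sum_gaussian_sum d_gt0 (@exp_sum_cosh_prod R d m).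
exists f; split.
(* As [f] is $C^2$ everywhere, the whole space is a single piece, with empty boundary. *)
- exists 1%N, (fun=> setT), (fun=> f); split.
  + by move=> _; exact: openT.
  + by move=> i j _ _ _; rewrite (ord1 i) (ord1 j).
  + by apply/seteqP; split=> // x _; exists ord0 => //; rewrite closureT.
  + by move=> _; rewrite closureT setDv; exact: negligible_set0.
  + by move=> _; split; [exact: Ck_leq Cf|].
- exact: vanishes_compactly_supported fn.
- move=> x xM; apply: glued1.
  by rewrite /r lerXn2r ?nnegrE ?sqrtr_ge0// ?ltW// (le_lt_trans _ xM)// sqrtr_ge0.
- exists 2^-1; split.
  + apply/andP; split; rewrite inE/=; first exact: continuous_measurable_rV.
    have [K K0 fK] : exists2 K, 0 <= K & forall x, `|(f \* f) x| <= K * expR (- enorm x ^+ 2).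
      apply: (@vanishes_gauss_bound _ _ (n + 1)) => [x|x rx]; last by rewrite /= fn// mulr0.
      by apply: continuousM; exact: cf.
    apply: (le_lt_trans (Lnorm2_le_gauss cf (C := K) _)); last exact: ltry.
    by move=> x; rewrite expr2 (le_trans (ler_norm _) (fK x)).
  + exact: Bnorm_lty Cf fn.
  + by apply/andP; split; lra.
  + exists N; split=> //; exists a, c; split=> [k _|]; first exact: c0.
    rewrite (_ : (fun x => _) = fun x => f x - g x); last first.
      by apply/funext => x; rewrite gE.
    apply: (le_trans (Lnorm2_le_gauss (C := eps) _ fg)).
      move=> x; apply: continuousB; first exact: cf.
      exact: Ck_continuous Cg _.
    rewrite lee_fin powR12_sqrt ?mulr_ge0 ?(ltW eps0) ?(ltW I0)//.
    rewrite (_ : eps * _ = 2^-1 ^+ 2) ?sqrtr_sqr ?ger0_norm//.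
    by rewrite /eps -/I; field; rewrite gt_eqF.
Qed.
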